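(* Let $m\in\mathbb{N}$ and $-1<\alpha<0$. The Type III exceptional $X_m$-Laguerre polynomials $\{L_{m,n}^{\mathrm{III},\alpha}\;:\;n=0,m+1,m+2,m+3,\ldots\}$ are orthogonal in the Hilbert space $L^2((0,\infty);W_m^{\mathrm{III},\alpha})$ and the norms are explicitly given by $$\int_0^\infty(L_{m,n}^{\mathrm{III},\alpha}(x))^2W_m^{\mathrm{III},\alpha}(x)\,dx=\begin{cases}\dfrac{n\,\Gamma(n-m+\alpha+1)}{(n-m-1)!}&\text{if }n\ge m+1,\\[10pt]\dfrac{\Gamma(\alpha+1)\Gamma(-\alpha)\,m!}{\Gamma(m-\alpha)}&\text{if }n=0.\end{cases}$$
   Context: $\mathbb{N}=\{1,2,\dots\}$. For $a\in\mathbb{R}$ and integer $n\ge0$ the classical Laguerre polynomial is $L_n^a(x)=\sum_{j=0}^n\binom{n+a}{n-j}\frac{(-x)^j}{j!}$, with $\binom{r}{i}=r(r-1)\cdots(r-i+1)/i!$; $L_n^a:=0$ for $n<0$. The Type III exceptional $X_m$-Laguerre polynomials are $L_{m,0}^{\mathrm{III},\alpha}(x)=1$ and, for $n\ge m+1$, $$L_{m,n}^{\mathrm{III},\alpha}(x)=xL_{n-m-2}^{\alpha+2}(x)L_m^{-\alpha-1}(-x)+(m+1)L_{n-m-1}^{\alpha+1}(x)L_{m+1}^{-\alpha-2}(-x).$$ The Type III weight is $W_m^{\mathrm{III},\alpha}(x)=\dfrac{x^\alpha e^{-x}}{(L_m^{-\alpha-1}(-x))^2}$ on $(0,\infty)$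 (for $-1<\alpha<0$, $L_m^{-\alpha-1}(-x)$ has no zeros in $[0,\infty)$). $L^2((0,\infty);W)$ is the Hilbert space of complex-valued measurable $f$ with $\int_0^\infty|f|^2W\,dx<\infty$ with the usual inner product. $\Gamma$ is the Gamma function. *)

(* Defs.v *)
From HB Require Import structures.
From mathcomp Require Import all_boot all_order all_algebra.
From mathcomp Require Import complex.
From mathcomp Require Import all_classical all_reals all_analysis.

Set Implicit Arguments.
Unset Strict Implicit.
Unset Printing Implicit Defensive.

Import Order.TTheory GRing.Theory Num.Theory.
Import numFieldNormedType.Exports.

Local Open Scope classical_set_scope.
Local Open Scope ring_scope.

Section Laguerre.
Context {R : realType}.
Implicit Types (r a s x : R) (m n i : nat).

Definition gbinom r i : R := (\prod_(j < i) (r - j%:R)) / i`!%:R.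

(* The degree is an [int] so that the convention L_n^a = 0 for n < 0 applies
   to index differences such as n - m - 2. *)
Definition laguerre (n : int) a : {poly R} :=
  match n with
  | Posz n => \sum_(j < n.+1)
      (gbinom (n%:R + a) (n - j) / j`!%:R) *: (- 'X) ^+ j
  | Negz _ => 0
  end.

(* L_n^a(-x) *)
Definition laguerre_opp (n : int) a : {poly R} := laguerre n a \Po (- 'X).

(* Only the indices in [XLaguerre_index m] are meaningful. *)
Definition XLaguerre3 m a n : {poly R} :=
  if n == 0%N then 1
  else 'X * laguerre (n%:Z - m%:Z - 2) (a + 2) * laguerre_opp m (- a - 1)
       + (m.+1)%:R *: (laguerre (n%:Z - m%:Z - 1) (a + 1)
                       * laguerre_opp m.+1 (- a - 2)).

Definition XLaguerre_index m : set nat :=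
  [set n | n = 0%N \/ (m.+1 <= n)%N].

Definition weight3 m a x : R :=
  x `^ a * expR (- x) / ((laguerre_opp m (- a - 1)).[x]) ^+ 2.

(* Euler's integral; it converges exactly for s > 0, and is only the Gamma
   function there. *)
Definition Gamma s : R :=
  \int[lebesgue_measure]_(x in `]0, +oo[) (x `^ (s - 1) * expR (- x)).

End Laguerre.

Section WeightedL2.
Context {R : realType}.
Local Open Scope complex_scope.
Implicit Types (W : R -> R) (f g : R -> R[i]).

(* R[i] carries no Borel sigma-algebra in the library: measurability and
   integration of complex-valued functions are taken componentwise. *)
Definition cmeasurable (D : set R) f : Prop :=
  measurable_fun D (fun x => complex.Re (f x)) /\
  measurable_fun D (fun x => complex.Im (f x)).

Definition cintegral (D : set R) f : R[i] :=
  (\int[lebesgue_measure]_(x in D) complex.Re (f x)) +i*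
  (\int[lebesgue_measure]_(x in D) complex.Im (f x)).

(* L^2((0,oo); W), given by representatives of its elements. *)
Definition L2 W : set (R -> R[i]) :=
  [set f | cmeasurable `]0, +oo[ f /\
    (\int[lebesgue_measure]_(x in `]0%R, +oo[)
        (ComplexField.Normc.normc (f x) ^+ 2 * W x)%:E < +oo)%E].

Definition L2_inner W f g : R[i] :=
  cintegral `]0, +oo[ (fun x => f x * (g x)^* * (W x)%:C).

Definition L2_orthogonal W (I : set nat) (F : nat -> R -> R[i]) : Prop :=
  (forall n, I n -> L2 W (F n)) /\
  (forall n k, I n -> I k -> n <> k -> L2_inner W (F n) (F k) = 0).

Definition poly_cfun (p : {poly R}) : R -> R[i] := fun x => (p.[x])%:C.

End WeightedL2.

(* Main.v *)
Require Import Defs.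
From mathcomp Require Import all_boot all_order all_algebra.
From mathcomp Require Import complex.
From mathcomp Require Import all_classical all_reals all_analysis.
From mathcomp Require Import measurable_realfun ring lra.
Import Order.TTheory GRing.Theory Num.Theory.
Import numFieldNormedType.Exports.
Local Open Scope classical_set_scope.
Local Open Scope ring_scope.

(** Write q = L_m^(-a-1)(-x), y_k = L_k^(a+1) and T_k for the exceptional
    polynomial of degree m+k+1. Every integral below has the shape
      I(s, r, p) = int_0^oo x^(s-1) e^(-x) p(x)/r(x) dx
    with p, r polynomials, r bounded away from 0 and s > 0, and everything
    follows from one fact: for such s, r, p,
      int_0^oo (x^s e^(-x) p/r)' dx = 0                  [gamma_integral_derive]
    because x^s e^(-x) p/r vanishes at both ends. Spelled out, this is a
    vanishing of I(s, r^2, _) at a polynomial, so that each evaluation is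
    reduced to choosing p and r and checking a polynomial identity.

    The exceptional polynomials are adapted to this. The function q is
    L_(m+1)^(-a-2)(-x)' and solves a second order equation; eliminating
    L_(m+1)^(-a-2)(-x) between the two gives
      (x^(a+1) e^(-x) y_k/q)' = - x^a e^(-x) T_k / q^2
                                                   [XLaguerre3_wronskian],
    while the Laguerre equation gives T_l' = (m+l+1) q y_l
                                                   [deriv_XLaguerre3].
    The first relation is the orthogonality of T_k to 1. Integrating it by
    parts against T_l moves the derivative to T_l, where the second relation
    cancels the denominator, and yields
      int T_k T_l W = (m+l+1) int y_k y_l x^(a+1) e^(-x) dx
                                                   [XLaguerre3_pairing].
    This leaves the classical Laguerre polynomials: they are orthogonal by the
    Sturm-Liouville form of their equation, and their norms satisfy
    (k+1) h_(k+1) = (k+1+a) h_k, seen by integrating the derivative of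
    x^(a+1) e^(-x) y_(k+1) y_k.

    For the norm of 1 let q_m vary with m. The contiguous relations give
      (x^(a+1) e^(-x) / (q_(m+1) q_m))'
        = (m-a) x^a e^(-x)/q_(m+1)^2 - (m+1) x^a e^(-x)/q_m^2,
    so the integrals of the weights satisfy a first order recurrence in m,
    which starts from Gamma(a+1) as q_0 = 1 and is solved by means of
    Gamma(s+1) = s Gamma(s). *)

Set Implicit Arguments.
Unset Strict Implicit.
Unset Printing Implicit Defensive.

(** * Primitives on the half-line *)
Section HalfLine.
Context {R : realType}.
Implicit Types (f F : R -> R) (x M : R).
Notation mu := (@lebesgue_measure R).
Notation halfline := (`]0 : R, +oo[%classic).

(** Compact intervals increasing to the open half-line: the fundamental theorem
    of calculus applies on each of them, away from the singularity at 0. *)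
Definition exhaust (n : nat) : set R := `[n.+2%:R^-1, n.+2%:R]%classic.

Lemma exhaust_gt0 n x : exhaust n x -> 0 < x.
Proof. by rewrite /exhaust /= in_itv/= => /andP[+ _]; apply: lt_le_trans. Qed.

Lemma exhaust_lt n : n.+2%:R^-1 < n.+2%:R :> R.
Proof. by rewrite (@lt_trans _ _ 1)// ?invf_lt1 ?ltr1n. Qed.

Lemma nondecreasing_exhaust : nondecreasing_seq exhaust.
Proof.
move=> m n mn; rewrite subsetEset /exhaust => x /=; rewrite !in_itv/= => /andP[mx xm].
rewrite (le_trans _ mx)/= ?(le_trans xm) ?ler_nat//.
by rewrite lef_pV2 ?posrE// ler_nat.
Qed.

Lemma near_exhaust x : 0 < x -> \forall n \near \oo, exhaust n x.
Proof.
move=> x0; near=> n; rewrite /exhaust /= in_itv/=; apply/andP; split.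
  rewrite invf_ple ?posrE//; apply: (@le_trans _ _ n%:R); last by rewrite ler_nat ltnW.
  by near: n; exact: nbhs_infty_ger.
apply: (@le_trans _ _ n%:R); last by rewrite ler_nat ltnW.
by near: n; exact: nbhs_infty_ger.
Unshelve. all: by end_near. Qed.

Lemma bigcup_exhaust : \bigcup_n exhaust n = halfline.
Proof.
apply/seteqP; split=> x /=; first by move=> [n _ /exhaust_gt0]; rewrite in_itv/= andbT.
rewrite in_itv/= andbT => /near_exhaust [n _ /(_ n (leqnn n))] ?; by exists n.
Qed.

Lemma measurable_halfline f : (forall x : R, 0 < x -> {for x, continuous f}) ->
  measurable_fun halfline f.
Proof.
move=> cf; apply: open_continuous_measurable_fun; first exact: interval_open.
by move=> x; rewrite inE/= in_itv/= andbT; apply: cf.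
Qed.

Lemma integral_exhaust f F n :
  (forall x : R, 0 < x -> {for x, continuous f}) ->
  (forall x : R, 0 < x -> is_derive x 1 F (f x)) ->
  (\int[mu]_(x in exhaust n) (f x)%:E = (F n.+2%:R - F n.+2%:R^-1)%:E)%E.
Proof.
move=> cf dF; rewrite /exhaust (@continuous_FTC2 _ _ F) ?exhaust_lt//.
- apply: continuous_in_subspaceT => x; rewrite inE => /exhaust_gt0; exact: cf.
- have cF : {within exhaust n, continuous F}.
    apply: derivable_within_continuous => x xI; apply: ex_derive; apply: dF.
    exact: (@exhaust_gt0 n).
  move/(continuous_within_itvP _ (exhaust_lt n)): cF => [_ ? ?]; split => // x xI.
  apply: ex_derive; apply: dF; apply: (@exhaust_gt0 n).
  by rewrite /exhaust/=; apply: subset_itv_oo_cc.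
- move=> x xI; rewrite derive1E; apply: derive_val; apply: dF; apply: (@exhaust_gt0 n).
  by rewrite /exhaust/=; apply: subset_itv_oo_cc.
Qed.

(** The integrals over the exhausting intervals are increments of F, hence at
    most 2M, and monotone convergence passes to the half-line. *)
Lemma integrable_of_bounded_primitive f F M :
  (forall x : R, 0 < x -> {for x, continuous f}) ->
  (forall x : R, 0 < x -> 0 <= f x) ->
  (forall x : R, 0 < x -> is_derive x 1 F (f x)) ->
  (forall x : R, 0 < x -> `|F x| <= M) ->
  mu.-integrable halfline (EFin \o f).
Proof.
move=> cf f0 dF FM; apply/integrableP; split.
  by apply/measurable_EFinP; exact: measurable_halfline.
have -> : (\int[mu]_(x in `]0%R, +oo[) `|(EFin \o f) x| =
    \int[mu]_(x in `]0%R, +oo[) (f x)%:E)%E.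
  apply: eq_integral => x; rewrite inE/= in_itv/= andbT => x0.
  by rewrite ger0_norm// f0.
apply: (@le_lt_trans _ _ (M + M)%:E); last exact: ltry.
rewrite -bigcup_exhaust.
have mI n : measurable (exhaust n) by exact: measurable_itv.
have := @ge0_nondecreasing_set_cvg_integral _ (measurableTypeR R) _ exhaust (EFin \o f) mu
  nondecreasing_exhaust mI.
have mf n : measurable_fun (exhaust n) (EFin \o f).
  apply: (@measurable_funS _ _ _ _ halfline) => //.
    by rewrite -bigcup_exhaust; exact: bigcup_sup.
  by apply/measurable_EFinP; exact: measurable_halfline.
have f0' n x : exhaust n x -> (0 <= (EFin \o f) x)%E.
  by move=> /exhaust_gt0 x0; rewrite lee_fin f0.
move=> /(_ mf f0') h; rewrite -(cvg_lim _ h)//; apply: lime_le.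
  by apply/cvg_ex; eexists; exact: h.
apply: nearW => n; rewrite (integral_exhaust n cf dF) lee_fin.
apply: (le_trans (ler_norm _)); apply: (le_trans (ler_normB _ _)).
by rewrite lerD// FM ?invr_gt0.
Qed.

(** No sign is imposed on f, so the passage from the exhausting intervals to the
    half-line is by domination by |f|. *)
Lemma Rintegral_derive_eq0 f F :
  (forall x : R, 0 < x -> {for x, continuous f}) ->
  (forall x : R, 0 < x -> is_derive x 1 F (f x)) ->
  mu.-integrable halfline (EFin \o f) ->
  F x @[x --> 0^'+] --> 0 -> F x @[x --> +oo] --> 0 ->
  \int[mu]_(x in `]0, +oo[) f x = 0.
Proof.
move=> cf dF fint F0 Foo.
have mf := measurable_int _ fint.
have [] := @dominated_convergence _ _ _ mu halfline (measurable_itv _)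
  (fun n => (EFin \o f) \_ (exhaust n)) (EFin \o f) (abse \o (EFin \o f)).
- move=> n; apply/measurable_restrict => //; first exact: measurable_itv.
  exact: (measurable_funS _ _ mf).
- exact: mf.
- apply: aeW => x /=; rewrite in_itv/= andbT => /near_exhaust xI.
  apply: cvg_near_cst; near=> n; rewrite patchE mem_set//.
  by near: n.
- exact: integrable_abse.
- apply: aeW => x n _; rewrite patchE; case: ifPn => //= _.
  by rewrite normr0 lee_fin.
move=> _ _.
under eq_fun => n.
  rewrite -integral_mkcondr setIidr; last first.
    by rewrite -bigcup_exhaust; exact: bigcup_sup.
  rewrite (integral_exhaust n cf dF).
  over.
move=> h; rewrite /Rintegral.
have F0n : F n.+2%:R^-1 @[n --> \oo] --> 0.
  move/cvg_at_rightP: F0; apply; split=> [n|]; first by rewrite invr_gt0.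
  apply/cvgr0Pnorm_le => e e0; near=> n.
  rewrite ger0_norm ?invr_ge0// invf_ple ?posrE//.
  apply: (@le_trans _ _ n%:R); last by rewrite ler_nat ltnW.
  by near: n; exact: nbhs_infty_ger.
have Foon : F n.+2%:R @[n --> \oo] --> 0.
  move/cvg_pinftyP: Foo; apply; apply/cvgryPge => A; near=> n.
  apply: (@le_trans _ _ n%:R); last by rewrite ler_nat ltnW.
  by near: n; exact: nbhs_infty_ger.
have h0 : (F n.+2%:R - F n.+2%:R^-1)%:E @[n --> \oo] --> 0%:E.
  by apply: cvg_EFin; [exact: nearW|rewrite -[0]subr0; exact: cvgB].
by have -> := cvg_unique _ h h0.
Unshelve. all: by end_near. Qed.

End HalfLine.

(** * Gamma-type integrals of rational functions *)
Section ExpRational.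
Context {R : realType}.
Implicit Types (p q r : {poly R}) (s x : R).
Notation mu := (@lebesgue_measure R).
Notation halfline := (`]0 : R, +oo[%classic).

(** The condition on denominators that makes p/r grow at most polynomially on the
    half-line, up to 0 included. *)
Definition bounded_away r := exists2 c : R, 0 < c & forall x, 0 < x -> c <= r.[x].

Lemma bounded_away1 : bounded_away 1.
Proof. by exists 1 => // x _; rewrite hornerC. Qed.

Lemma bounded_awayM p r : bounded_away p -> bounded_away r -> bounded_away (p * r).
Proof.
move=> [c c0 cp] [d d0 dr]; exists (c * d); first exact: mulr_gt0.
by move=> x x0; rewrite hornerM ler_pM ?cp ?dr// ltW.
Qed.

Lemma bounded_away_gt0 r x : bounded_away r -> 0 < x -> 0 < r.[x].
Proof. by move=> [c c0 cr] x0; apply: (lt_le_trans c0); exact: cr. Qed.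

Lemma continuous_powR_gt0 (a x : R) : 0 < x -> {for x, continuous (fun y => y `^ a)}.
Proof.
move=> x0; apply: differentiable_continuous; apply/derivable1_diffP.
by apply: derivable_powR; rewrite in_itv/= andbT.
Qed.

(** [s] is the exponent of Euler's integral, so that [gamma_integral s 1 1] is
    Gamma(s). The integral converges when s > 0 and [bounded_away r]. *)
Definition gamma_integrand s r p x : R := x `^ (s - 1) * expR (- x) * (p.[x] / r.[x]).

Definition gamma_integral s r p : R := \int[mu]_(x in halfline) gamma_integrand s r p x.

Lemma continuous_gamma_integrand s r p x : bounded_away r -> 0 < x ->
  {for x, continuous (gamma_integrand s r p)}.
Proof.
move=> r0 x0; apply: (@cvgM _ _ _ _ (fun x => x `^ (s - 1) * expR (- x)) (fun x => p.[x] / r.[x])).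
  apply: (@cvgM _ _ _ _ (fun x => x `^ (s - 1)) (fun x => expR (- x))).
    exact: (@continuous_powR_gt0 (s - 1)).
  apply: (@continuous_comp _ _ _ -%R expR); first exact: opp_continuous.
  exact: continuous_expR.
apply: (@cvgM _ _ _ _ (horner p) (fun x => (horner r x)^-1)); first exact: continuous_horner.
apply: cvgV; first by rewrite gt_eqF// bounded_away_gt0.
exact: continuous_horner.
Qed.

Lemma poly_growth p : exists2 C : R, 0 <= C &
  forall x, 0 < x -> `|p.[x]| <= C * (1 + x) ^+ size p.
Proof.
exists (\sum_(i < size p) `|p`_i|); first by apply: sumr_ge0.
move=> x x0; rewrite horner_coef mulr_suml (le_trans (ler_norm_sum _ _ _))//.
apply: ler_sum => i _; rewrite normrM ler_wpM2l//.
rewrite ger0_norm ?exprn_ge0 ?(ltW x0)//.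
apply: (@le_trans _ _ ((1 + x) ^+ i)).
  by apply: lerXn2r; rewrite ?nnegrE ?addr_ge0 ?(ltW x0)// lerDr.
by rewrite ler_weXn2l ?(ltnW (ltn_ord i))// lerDl ltW.
Qed.

Lemma exp_decay n x : 0 < x -> (1 + x) ^+ n * expR (- x) <= n`!%:R * expR 1.
Proof.
move=> x0; rewrite expRN ler_pdivrMr ?expR_gt0// -mulrA -expRD.
rewrite mulrC -ler_pdivrMr ?ltr0n ?fact_gt0//.
case: n => [|n]; last first.
  apply: le_trans (expR_ge1Dxn n _); first by rewrite lerDr.
  by rewrite addr_ge0 ?ltW.
by rewrite expr0 fact0 divr1 (le_trans _ (expR_ge1Dx _))// lerDl addr_ge0 ?ltW.
Qed.

(** The exponential beats any power; M is real since it will be s + 1. *)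
Lemma rational_decay (M : R) r p : bounded_away r -> exists2 K : R, 0 <= K &
  forall x, 0 < x -> `|expR (- x) * (p.[x] / r.[x])| <= K * (1 + x) `^ (- M).
Proof.
move=> r0; have [c c0 cr] := r0; have [C C0 Cp] := poly_growth p.
(* The exponent n.+1 is a natural number above M, so that the exponential series
   applies. *)
pose n := Num.truncn `|M|.
exists (C / c * ((size p + n.+1)`!%:R * expR 1)).
  by rewrite !mulr_ge0 ?invr_ge0 ?expR_ge0// ltW.
move=> x x0; rewrite normrM ger0_norm ?expR_ge0//.
have x1 : 0 < 1 + x by rewrite addr_gt0.
have pr : `|p.[x] / r.[x]| <= C / c * (1 + x) ^+ size p.
  rewrite normrM mulrAC ler_pM//; first exact: Cp.
  rewrite ger0_norm ?invr_ge0 ?(ltW (bounded_away_gt0 r0 x0))//.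
  by rewrite lef_pV2 ?posrE ?bounded_away_gt0 ?cr.
rewrite mulrC powRN ler_pdivlMr ?powR_gt0//.
have Mn : (1 + x) `^ M <= (1 + x) ^+ n.+1.
  rewrite -powR_mulrn ?(ltW x1)//; apply: ler_powR; first by rewrite lerDl ltW.
  by apply: (le_trans (ler_norm _)); exact/ltW/truncnS_gt.
apply: (@le_trans _ _ ((C / c * (1 + x) ^+ size p) * expR (- x) * (1 + x) ^+ n.+1)).
  by rewrite ler_pM ?mulr_ge0 ?expR_ge0 ?powR_ge0// ler_wpM2r ?expR_ge0.
rewrite -!mulrA ler_wpM2l// ler_wpM2l ?invr_ge0 ?(ltW c0)//.
rewrite [expR _ * _]mulrC mulrA -exprD; exact: exp_decay.
Qed.

(** The derivative of (x/(1+x))^s, which is bounded by 1 and behaves like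
    s x^(s-1) near 0: the comparison function for gamma-type integrands on the
    whole half-line at once. *)
Definition beta_kernel s x : R := s * x `^ (s - 1) * (1 + x) `^ (- (s + 1)).

Lemma integrable_beta_kernel s : 0 < s ->
  mu.-integrable halfline (EFin \o beta_kernel s).
Proof.
move=> s0; have p1 x : 0 < x -> 0 < 1 + x by move=> ?; rewrite addr_gt0.
apply: (@integrable_of_bounded_primitive _ _ (fun x => x `^ s * (1 + x) `^ (- s)) 1).
- move=> x x0; apply: (@cvgM _ _ _ _ (fun x => s * x `^ (s - 1)) (fun x => (1 + x) `^ (- (s + 1)))).
    apply: cvgMr; exact: (@continuous_powR_gt0 (s - 1)).
  apply: (@continuous_comp _ _ _ (fun x => 1 + x) (fun y => y `^ (- (s + 1)))).
    by apply: cvgD; [exact: cvg_cst|exact: cvg_id].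
  by apply: (@continuous_powR_gt0 (- (s + 1))); exact: p1.
- by move=> x x0; rewrite !mulr_ge0 ?powR_ge0// ltW.
- move=> x x0; have x1 := p1 _ x0.
  have d1 : is_derive x 1 (fun y : R => 1 + y) 1.
    have dD := is_deriveD (is_derive_cst (1 : R) x 1) (is_derive_id x (1 : R)).
    by apply: (is_derive_eq dD); rewrite add0r.
  have d2 := @is_derive1_comp R (fun z : R => z `^ (- s)) (fun y => 1 + y) x _ _
    (is_derive1_powR (- s) x1) d1.
  apply: (is_derive_eq (is_deriveM (is_derive1_powR s x0) d2)).
  rewrite /beta_kernel /GRing.scale/= opprD.
  rewrite -(mulr_powRB1 (ltW x0) s0).
  have -> : (1 + x) `^ (- s) = (1 + x) * (1 + x) `^ (- s - 1).
    rewrite -{2}[1 + x]powRr1 ?(ltW x1)// -powRD ?(gt_eqF x1) ?implybT//.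
    by congr (_ `^ _); ring.
  by ring.
- move=> x x0; have x1 := p1 _ x0.
  rewrite ger0_norm ?mulr_ge0 ?powR_ge0// powRN ler_pdivrMr ?powR_gt0// mul1r.
  by apply: ge0_ler_powR; rewrite ?nnegrE ?(ltW s0) ?(ltW x0) ?(ltW x1)// lerDr.
Qed.

Lemma integrable_gamma_integrand s r p : 0 < s -> bounded_away r ->
  mu.-integrable halfline (EFin \o gamma_integrand s r p).
Proof.
move=> s0 r0; have [K K0 HK] := rational_decay (s + 1) p r0.
have iK : mu.-integrable halfline
    (EFin \o (fun x => K / s * beta_kernel s x)).
  rewrite (_ : _ \o _ = (fun x => (K / s)%:E * (EFin \o beta_kernel s) x)%E)//.
  by apply: integrableZl; [exact: measurable_itv|exact: integrable_beta_kernel].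
apply: le_integrable iK; first exact: measurable_itv.
  apply/measurable_EFinP; apply: measurable_halfline => x; exact: continuous_gamma_integrand.
move=> x /=; rewrite in_itv/= andbT => x0; rewrite lee_fin.
rewrite [leRHS]ger0_norm; last first.
  by rewrite /beta_kernel !mulr_ge0 ?powR_ge0 ?invr_ge0 ?(ltW s0).
rewrite /gamma_integrand -mulrA normrM ger0_norm ?powR_ge0//.
rewrite /beta_kernel [leRHS](_ : _ = x `^ (s - 1) * (K * (1 + x) `^ (- (s + 1)))).
  by rewrite ler_wpM2l ?powR_ge0// HK.
by field; rewrite gt_eqF.
Qed.

Lemma gamma_integralE s r p : 0 < s -> bounded_away r ->
  (\int[mu]_(x in halfline) (gamma_integrand s r p x)%:E = (gamma_integral s r p)%:E)%E.
Proof.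
move=> s0 r0; rewrite /gamma_integral /Rintegral fineK//.
by apply: integrable_fin_num => //; exact: (integrable_gamma_integrand p s0 r0).
Qed.

Lemma gamma_integralD s r p q : 0 < s -> bounded_away r ->
  gamma_integral s r (p + q) = gamma_integral s r p + gamma_integral s r q.
Proof.
move=> s0 r0; rewrite /gamma_integral -RintegralD//; try exact: integrable_gamma_integrand.
by apply: eq_Rintegral => x _; rewrite /gamma_integrand hornerD mulrDl mulrDr.
Qed.

Lemma gamma_integralZ s r (c : R) p : 0 < s -> bounded_away r ->
  gamma_integral s r (c *: p) = c * gamma_integral s r p.
Proof.
move=> s0 r0; rewrite /gamma_integral -RintegralZl//; last exact: integrable_gamma_integrand.
by apply: eq_Rintegral => x _; rewrite /gamma_integrand hornerZ; ring.
Qed.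

Lemma gamma_integral_cancel s r q p : bounded_away q ->
  gamma_integral s (r * q) (p * q) = gamma_integral s r p.
Proof.
move=> q0; apply: eq_Rintegral => x; rewrite inE/= in_itv/= andbT => x0.
by rewrite /gamma_integrand !hornerM -mulf_div divff ?mulr1// gt_eqF// bounded_away_gt0.
Qed.

Lemma gamma_integral_shift s r p : 0 < s ->
  gamma_integral s r ('X * p) = gamma_integral (s + 1) r p.
Proof.
move=> s0; apply: eq_Rintegral => x; rewrite inE/= in_itv/= andbT => x0.
by rewrite /gamma_integrand addrK hornerM hornerX -(mulr_powRB1 (ltW x0) s0); ring.
Qed.

(** The integrand is the derivative of x^s e^(-x) p/r. That function is
    dominated by x^s (1+x)^(-s-1), which is at most x^s near 0 and 1/x near
    infinity. *)
Lemma gamma_integral_derive s r p : 0 < s -> bounded_away r ->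
  gamma_integral s (r ^+ 2)
    ((s%:P - 'X) * p * r + 'X * (p^`() * r - p * r^`())) = 0.
Proof.
move=> s0 r0; have r20 : bounded_away (r ^+ 2) by rewrite expr2; exact: bounded_awayM.
pose F x : R := x `^ s * expR (- x) * (p.[x] / r.[x]).
have [K K0 HK] := rational_decay (s + 1) p r0.
have F_le x : 0 < x -> `|F x| <= K * (x `^ s * (1 + x) `^ (- (s + 1))).
  move=> x0; rewrite /F -mulrA normrM [`|x `^ s|]ger0_norm ?powR_ge0//.
  by rewrite [leRHS]mulrCA ler_wpM2l ?powR_ge0 ?HK.
apply: (@Rintegral_derive_eq0 _ _ F).
- by move=> x; exact: continuous_gamma_integrand.
- move=> x x0; have rx := bounded_away_gt0 r0 x0.
  have dp : is_derive x 1 (horner p) p^`().[x] by exact: is_derive_poly.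
  have dr : is_derive x 1 (horner r) r^`().[x] by exact: is_derive_poly.
  have de : is_derive x 1 (fun y : R => expR (- y)) (- expR (- x)).
    apply: (is_derive_eq (@is_derive1_comp R expR -%R x _ _ _ _)).
    by rewrite mulrN1.
  have drV := is_deriveV (lt0r_neq0 rx) dr.
  apply: (is_derive_eq (is_deriveM (is_deriveM (is_derive1_powR s x0) de) (is_deriveM dp drV))).
  rewrite /gamma_integrand /GRing.scale/= !fctE !(hornerE, hornerXn, horner_exp).
  rewrite /= -(mulr_powRB1 (ltW x0) s0).
  by field; rewrite gt_eqF.
- exact: integrable_gamma_integrand.
- apply/cvgr0Pnorm_le => e e0.
  have : K * x `^ s @[x --> 0^'+] --> K * 0 by apply: cvgMr; exact: powR_cvg0.
  rewrite mulr0 => /cvgr0Pnorm_le /(_ _ e0) xs.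
  near=> x; have x0 : 0 < x by [].
  apply: (le_trans (F_le _ x0)); apply: (@le_trans _ _ `|K * x `^ s|); last by near: x.
  rewrite ger0_norm ?mulr_ge0 ?powR_ge0// ler_wpM2l// ler_piMr ?powR_ge0//.
  rewrite powRN invf_le1 ?powR_gt0 ?addr_gt0// -[leLHS](powRr0 (1 + x)).
  by apply: ler_powR; rewrite ?lerDl ?addr_ge0 ?ltW.
- apply/cvgr0Pnorm_le => e e0; near=> x.
  have x0 : 0 < x by [].
  apply: (le_trans (F_le _ x0)); apply: (@le_trans _ _ (K * x^-1)).
    rewrite ler_wpM2l// powRN ler_pdivrMr ?powR_gt0 ?addr_gt0//.
    rewrite powRD ?(gt_eqF (addr_gt0 _ _)) ?implybT// powRr1 ?addr_ge0 ?(ltW x0)//.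
    rewrite mulrCA -[leLHS]mulr1 ler_pM ?powR_ge0//.
      by apply: ge0_ler_powR; rewrite ?nnegrE ?addr_ge0 ?(ltW s0) ?(ltW x0)// lerDr.
    by rewrite ler_pdivlMl// mulr1 lerDr.
  rewrite ler_pdivrMr// mulrC -ler_pdivrMr//.
Unshelve. all: by end_near. Qed.

End ExpRational.

(** * Polynomial identities for Laguerre polynomials *)

(* Unfolding a polynomial whose degree is an explicit [Posz] would break the
   syntactic matching of the identities below. *)
Local Arguments laguerre {R} n a : simpl never.

Section LaguerreIdentities.
Context {R : realType}.
Implicit Types (p q r : {poly R}) (a s x : R) (n i j k m : nat).

Lemma gbinom0 s : gbinom s 0 = 1.
Proof. by rewrite /gbinom big_ord0 fact0 divr1. Qed.

Lemma fact_neq0 n : n`!%:R != 0 :> R.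
Proof. by rewrite pnatr_eq0 -lt0n fact_gt0. Qed.

(** With [gbinom_pascal], the only facts on binomials behind the contiguous
    relations. *)
Lemma gbinom_absorb s i : i.+1%:R * gbinom s i.+1 = s * gbinom (s - 1) i.
Proof.
rewrite /gbinom big_ord_recl /= subr0 factS natrM.
under eq_bigr => j _ do rewrite /bump /= add1n -natr1 opprD addrA addrAC.
by field; rewrite fact_neq0 ?natr1 ?nat1r pnatr_eq0.
Qed.

Lemma gbinom_pascal s i : gbinom s i.+1 = gbinom (s - 1) i.+1 + gbinom (s - 1) i.
Proof.
have i0 : i.+1%:R != 0 :> R by rewrite pnatr_eq0.
apply: (mulfI i0); rewrite gbinom_absorb mulrDr.
rewrite {2}/gbinom big_ord_recr /= factS natrM /gbinom.
by rewrite -natr1 in i0 *; field; rewrite fact_neq0 i0.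
Qed.

Lemma gbinom_gt0 s i : i%:R - 1 < s -> 0 < gbinom s i.
Proof.
move=> si; rewrite /gbinom divr_gt0 ?ltr0n ?fact_gt0//; apply: prodr_gt0 => j _.
rewrite subr_gt0; apply: le_lt_trans si.
by rewrite lerBrDr natr1 ler_nat.
Qed.

Lemma laguerre_oppE n a : laguerre_opp n a =
  \poly_(j < n.+1) (gbinom (n%:R + a) (n - j) / j`!%:R).
Proof.
rewrite /laguerre_opp /laguerre poly_def linear_sum /=; apply: eq_bigr => j _.
by rewrite linearZ /= rmorphXn /= rmorphN /= comp_polyX opprK.
Qed.

Lemma coef_laguerre_opp n a j : (laguerre_opp n a)`_j =
  if (j <= n)%N then gbinom (n%:R + a) (n - j) / j`!%:R else 0.
Proof. by rewrite laguerre_oppE coef_poly ltnS. Qed.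

Lemma laguerreE n a : laguerre n a = laguerre_opp n a \Po (- 'X).
Proof. by rewrite /laguerre_opp -comp_polyA rmorphN /= comp_polyX opprK comp_polyXr. Qed.

Lemma laguerre_opp0 a : laguerre_opp 0%N a = 1.
Proof. by rewrite laguerre_oppE poly_def big_ord1 /= gbinom0 fact0 divr1 scale1r. Qed.

Lemma deriv_laguerre_opp n a :
  (laguerre_opp n.+1 a)^`() = laguerre_opp n (a + 1).
Proof.
apply/polyP => j; rewrite coef_deriv !coef_laguerre_opp ltnS.
case: ifP => jn; last by rewrite mul0rn.
rewrite -[LHS]mulr_natr subSS factS natrM -!natr1.
have -> : n%:R + 1 + a = n%:R + (a + 1) by ring.
by field; rewrite fact_neq0 ?natr1 ?nat1r pnatr_eq0.
Qed.

Lemma coefX_deriv p j : ('X * p^`())`_j = j%:R * p`_j.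
Proof. by rewrite coefXM; case: j => [|j] /=; rewrite ?mul0r// coef_deriv mulr_natl. Qed.

(** Coefficientwise this is the absorption identity. *)
Lemma laguerre_opp_lower n a :
  'X * (laguerre_opp n.+1 a)^`() =
  n.+1%:R *: laguerre_opp n.+1 a - (n.+1%:R + a) *: laguerre_opp n a.
Proof.
apply/polyP => j; rewrite coefX_deriv coefB !coefZ !coef_laguerre_opp.
have [jn|nj] := leqP j n; last first.
  rewrite mulr0 subr0; have [jn|] := leqP j n.+1; last by rewrite !mulr0.
  by have -> : j = n.+1 by apply/eqP; rewrite eqn_leq jn nj.
rewrite (leqW jn) subSn//; have := gbinom_absorb (n.+1%:R + a) (n - j).
rewrite (_ : n.+1%:R + a - 1 = n%:R + a); last by rewrite -natr1; ring.
rewrite -!natr1 natrB// => H.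
rewrite mulrA [X in _ - X]mulrA -H.
by field; rewrite fact_neq0.
Qed.

(** Coefficientwise this combines absorption and Pascal's rule. *)
Lemma laguerre_opp_raise n a :
  'X * (laguerre_opp n a)^`() =
  n.+1%:R *: laguerre_opp n.+1 a - ((n.+1%:R + a)%:P + 'X) * laguerre_opp n a.
Proof.
apply/polyP => j; rewrite coefX_deriv coefB mulrDl coefD coefCM coefXM coefZ.
rewrite !coef_laguerre_opp; case: j => [|j] /=.
  rewrite !subn0 fact0 !divr1 gbinom_absorb mul0r addr0.
  rewrite (_ : n.+1%:R + a - 1 = n%:R + a) ?subrr//.
  by rewrite -natr1; ring.
have [jn|nj] := ltnP j n; last first.
  rewrite !mulr0 add0r ltnS; have [jn|] := leqP j n; last by rewrite !mulr0 subrr.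
  have -> : j = n by apply/eqP; rewrite eqn_leq jn nj.
  rewrite !subnn !gbinom0 factS natrM -natr1.
  by field; rewrite fact_neq0 ?natr1 ?nat1r pnatr_eq0.
rewrite ltnS (ltnW jn) subSS -(subnSK jn) factS natrM.
have := gbinom_absorb (n.+1%:R + a) (n - j.+1).
have := gbinom_pascal (n.+1%:R + a) (n - j.+1).
rewrite (_ : n.+1%:R + a - 1 = n%:R + a); last by rewrite -natr1; ring.
rewrite -!natr1 natrB// -natr1.
set g1 := gbinom _ _; set g2 := gbinom _ (n - j.+1).+1; set g3 := gbinom _ _.
move=> H1 H2.
have -> : g2 = g1 - g3 by rewrite H1; ring.
have H3 : (n%:R + 1 + a) * g3 = (n%:R - j%:R) * g1 by rewrite -H2; ring.
have e : (n%:R + 1 + a) * (g3 / ((j%:R + 1) * j`!%:R)) =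
  (n%:R - j%:R) * g1 / ((j%:R + 1) * j`!%:R) by rewrite mulrA H3.
by rewrite e; field; rewrite fact_neq0 ?natr1 ?nat1r pnatr_eq0.
Qed.

(** Differentiating the lowering relation and eliminating the neighbour with the
    raising one gives X times the equation. *)
Lemma laguerre_opp_ode n a : let u := laguerre_opp n a in
  'X * u^`()^`() + ((a + 1)%:P + 'X) * u^`() = n%:R *: u.
Proof.
case: n => [|n] /=.
  by rewrite laguerre_opp0 derivC deriv0 !mulr0 addr0 scale0r.
have L := laguerre_opp_lower n a; have U := laguerre_opp_raise n a.
set u := laguerre_opp n.+1 a in L U *; set v := laguerre_opp n a in L U *.
have dL := congr1 (fun p : {poly R} => 'X * p^`()) L.
rewrite derivM derivX derivB !derivZ -!mul_polyC in dL.
rewrite -!mul_polyC in L U *.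
set N : {poly R} := n.+1%:R%:P in L U dL *.
have ca : (n.+1%:R + a)%:P = N + a%:P by rewrite polyCD.
rewrite ca in L U dL; rewrite polyCD.
apply: (mulfI (negbT (polyX_eq0 R))).
have -> : 'X * ('X * u^`()^`() + (a%:P + 1%:P + 'X) * u^`()) =
    'X * (1 * u^`() + 'X * u^`()^`()) + (a%:P + 'X) * ('X * u^`()) by ring.
have -> : 'X * (N * u) =
    (N + a%:P + 'X) * (('X * u^`()) + (N + a%:P) * v)
    - (N + a%:P) * ('X * v^`() + (N + a%:P + 'X) * v) by rewrite U L; ring.
by rewrite dL; ring.
Qed.

Lemma deriv_laguerre n a :
  (laguerre n.+1 a)^`() = - laguerre n (a + 1).
Proof.
by rewrite !laguerreE deriv_comp derivN derivX mulrN1 deriv_laguerre_opp.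
Qed.

Lemma deriv_laguerreE n a :
  (laguerre n a)^`() = - ((laguerre_opp n a)^`() \Po - 'X).
Proof. by rewrite laguerreE deriv_comp derivN derivX mulrN1. Qed.

Lemma laguerre_ode n a : let y := laguerre n a in
  'X * y^`()^`() + ((a + 1)%:P - 'X) * y^`() = - (n%:R *: y).
Proof.
move=> y; have := congr1 (fun p : {poly R} => p \Po - 'X) (laguerre_opp_ode n a).
rewrite /= /y !deriv_laguerreE laguerreE; move: (laguerre_opp n a) => u.
rewrite derivN deriv_comp [(- 'X)^`()]derivN derivX mulrN1 opprK.
rewrite comp_polyD !comp_polyM comp_polyD comp_polyX comp_polyC comp_polyZ => <-.
by ring.
Qed.

Lemma laguerre_lower n a :
  'X * (laguerre n.+1 a)^`() =
  n.+1%:R *: laguerre n.+1 a - (n.+1%:R + a) *: laguerre n a.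
Proof.
have := congr1 (fun p : {poly R} => p \Po - 'X) (laguerre_opp_lower n a).
rewrite /= comp_polyB comp_polyM !comp_polyZ comp_polyX -!laguerreE => <-.
by rewrite deriv_laguerreE; ring.
Qed.

Lemma laguerre_raise n a :
  'X * (laguerre n a)^`() =
  n.+1%:R *: laguerre n.+1 a - ((n.+1%:R + a)%:P - 'X) * laguerre n a.
Proof.
have := congr1 (fun p : {poly R} => p \Po - 'X) (laguerre_opp_raise n a).
rewrite /= comp_polyB !comp_polyM comp_polyD comp_polyZ comp_polyX comp_polyC -!laguerreE => <-.
by rewrite deriv_laguerreE; ring.
Qed.

Lemma laguerre0 a : laguerre 0%N a = 1.
Proof. by rewrite laguerreE laguerre_opp0 rmorph1. Qed.

(** The form used throughout: the first summand of the definition contains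
    L_(k-1)^(a+2) = - (L_k^(a+1))', also for k = 0 where both sides are 0. *)
Lemma XLaguerre3E m a k :
  let y := laguerre k (a + 1) in let q := laguerre_opp m (- a - 1) in
  XLaguerre3 m a (m + k).+1 =
  (m.+1)%:R *: (y * laguerre_opp m.+1 (- a - 2)) - 'X * y^`() * q.
Proof.
move=> y q; rewrite /XLaguerre3 -[_ == 0%N]/false {}/y {}/q.
have -> : (m + k).+1%:Z - m%:Z - 1 = k%:Z by rewrite -addn1 !PoszD; ring.
have -> : (m + k).+1%:Z - m%:Z - 2 = k%:Z - 1 by rewrite -addn1 !PoszD; ring.
rewrite addrC; congr (_ + _); case: k => [|k].
  by rewrite laguerre0 derivC !(mulr0, mul0r) oppr0.
rewrite deriv_laguerre (_ : k.+1%:Z - 1 = k%:Z).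
  by rewrite (_ : a + 1 + 1 = a + 2); ring.
by rewrite -addn1 PoszD addrK.
Qed.

Lemma deriv_XLaguerre_den m a :
  (laguerre_opp m.+1 (- a - 2))^`() = laguerre_opp m (- a - 1).
Proof. by rewrite deriv_laguerre_opp; congr laguerre_opp; ring. Qed.

(** The differential equation of L_(m+1)^(-a-2)(-x), whose derivative is the
    denominator q, has no other term in that polynomial than the one on the
    left; hence it can be eliminated in favour of q. *)
Lemma XLaguerre_den_eq m a : let q := laguerre_opp m (- a - 1) in
  (m.+1)%:R *: laguerre_opp m.+1 (- a - 2) =
  'X * q^`() + ('X - (a + 1)%:P) * q.
Proof.
rewrite /= -laguerre_opp_ode deriv_XLaguerre_den; congr (_ + _ * _).
by rewrite addrC -polyCN; congr (_ + _%:P); ring.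
Qed.

(** The numerator of (x^(a+1) e^(-x) y/q)' over x^a e^(-x)/q^2. *)
Lemma XLaguerre3_wronskian m a k :
  let y := laguerre k (a + 1) in let q := laguerre_opp m (- a - 1) in
  ((a + 1)%:P - 'X) * y * q + 'X * (y^`() * q - y * q^`()) =
  - XLaguerre3 m a (m + k).+1.
Proof.
move=> y q; rewrite XLaguerre3E -/y -/q scalerAr XLaguerre_den_eq -/q; ring.
Qed.

(** All terms in q' cancel after the elimination of L_(m+1)^(-a-2)(-x), and the
    Laguerre equation turns the rest into a multiple of y. *)
Lemma deriv_XLaguerre3 m a k :
  let y := laguerre k (a + 1) in let q := laguerre_opp m (- a - 1) in
  (XLaguerre3 m a (m + k).+1)^`() = (m + k).+1%:R *: (y * q).
Proof.
move=> y q; rewrite XLaguerre3E -/y -/q derivB derivZ !derivM derivX.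
rewrite deriv_XLaguerre_den -/q scalerDr !scalerAr XLaguerre_den_eq -/q.
have H := laguerre_ode k (a + 1); rewrite /= -/y in H.
have -> : (1 * y^`() + 'X * y^`()^`()) * q =
    ('X * y^`()^`() + ((a + 1 + 1)%:P - 'X) * y^`()) * q
    + y^`() * (1 - (a + 1 + 1)%:P + 'X) * q by ring.
rewrite H (_ : (m + k).+1%:R = m.+1%:R + k%:R); last by rewrite -natrD addSn.
rewrite scalerDl -!mul_polyC; rewrite !polyCD. ring.
Qed.

End LaguerreIdentities.

(** * Integrals *)
Section LaguerreIntegrals.
Context {R : realType}.
Implicit Types (p q r : {poly R}) (a s x : R) (n i j k m : nat).
Notation mu := (@lebesgue_measure R).
Notation halfline := (`]0 : R, +oo[%classic).

Lemma gamma_integralB s r p q : 0 < s -> bounded_away r ->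
  gamma_integral s r (p - q) = gamma_integral s r p - gamma_integral s r q.
Proof.
by move=> s0 r0; rewrite gamma_integralD// -scaleN1r gamma_integralZ// mulN1r.
Qed.

Lemma gamma_integral_derive1 s p : 0 < s ->
  gamma_integral s 1 ((s%:P - 'X) * p + 'X * p^`()) = 0.
Proof.
move=> s0; rewrite -[RHS](gamma_integral_derive p s0 bounded_away1) expr1n.
by congr gamma_integral; rewrite derivC; ring.
Qed.

Lemma GammaE s : Gamma s = gamma_integral s 1 1.
Proof.
by apply: eq_Rintegral => x _; rewrite /gamma_integrand hornerC divr1 mulr1.
Qed.

Lemma GammaS s : 0 < s -> Gamma (s + 1) = s * Gamma s.
Proof.
move=> s0; rewrite !GammaE -gamma_integral_shift// -gamma_integralZ//; last exact: bounded_away1.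
apply/eqP; rewrite -subr_eq0 -gamma_integralB//; last exact: bounded_away1.
rewrite -oppr_eq0 -mulN1r -gamma_integralZ//; last exact: bounded_away1.
rewrite -[X in _ == X](gamma_integral_derive1 1 s0); apply/eqP; congr gamma_integral.
by rewrite derivC -!mul_polyC; ring.
Qed.

(** On [1, 2] the integrand is at least e^(-2)/2, as x^s >= 1 and x <= 2. *)
Lemma Gamma_gt0 s : 0 < s -> 0 < Gamma s.
Proof.
move=> s0; have h1 : bounded_away (1 : {poly R}) by exact: bounded_away1.
pose c : R := expR (- 2) / 2.
have c0 : 0 < c by rewrite divr_gt0 ?expR_gt0.
rewrite GammaE -lte_fin -gamma_integralE//.
have f_ge0 x : (0 <= (gamma_integrand s 1 1 x)%:E)%E.
  by rewrite lee_fin /gamma_integrand hornerC divr1 !mulr_ge0 ?powR_ge0 ?expR_ge0.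
apply: (@lt_le_trans _ _ (\int[mu]_(x in `[1%R, 2%R]) c%:E)%E).
  rewrite integral_cst/= ?lebesgue_measure_itv/=; last exact: measurable_itv.
  rewrite lte_fin ltr1n -EFinB -EFinM lte_fin mulr_gt0//; lra.
have sub : `[1 : R, 2]%classic `<=` halfline.
  by move=> x /=; rewrite !in_itv/= andbT => /andP[+ _]; apply: lt_le_trans.
have mf := measurable_int _ (integrable_gamma_integrand 1 s0 h1).
apply: (@le_trans _ _ (\int[mu]_(x in `[1%R, 2%R]) (gamma_integrand s 1 1 x)%:E)%E); last first.
  by apply: ge0_subset_integral => //; exact: measurable_itv.
apply: ge0_le_integral => //.
- by move=> x _; rewrite lee_fin ltW.
- exact: (measurable_funS _ sub mf).
move=> x /=; rewrite in_itv/= => /andP[x1 x2]; rewrite lee_fin.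
have x0 : 0 < x by exact: lt_le_trans x1.
rewrite /gamma_integrand hornerC divr1 mulr1 /c mulrC ler_pM ?expR_ge0 ?invr_ge0//.
  rewrite powRB ?powRr1 ?(ltW x0) ?(gt_eqF x0) ?implybT// -[leLHS]mul1r ler_pM ?invr_ge0//.
    by rewrite -(powRr0 x) ler_powR// ltW.
  by rewrite lef_pV2 ?posrE.
by rewrite ler_expR lerN2.
Qed.

(** Sturm-Liouville: (l-k) x^a e^(-x) y_k y_l is the derivative of
    x^(a+1) e^(-x) (y_k' y_l - y_k y_l'). *)
Lemma laguerre_orthogonal a k l : -1 < a -> k <> l ->
  gamma_integral (a + 1) 1 (laguerre k a * laguerre l a) = 0.
Proof.
move=> a1 kl; have s0 : 0 < a + 1 by rewrite -ltrBlDr sub0r.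
have := gamma_integral_derive1
  ((laguerre k a)^`() * laguerre l a - laguerre k a * (laguerre l a)^`()) s0.
rewrite [X in gamma_integral _ _ X](_ : _ = (l%:R - k%:R) *: (laguerre k a * laguerre l a)).
  rewrite gamma_integralZ//; last exact: bounded_away1.
  move/eqP; rewrite mulf_eq0 subr_eq0 eqr_nat => /orP[/eqP lk|/eqP//].
  by case: kl.
have := laguerre_ode k a; have := laguerre_ode l a => /=.
set y := laguerre l a; set z := laguerre k a => Hy Hz.
rewrite derivB !derivM.
transitivity (y * ('X * z^`()^`() + ((a + 1)%:P - 'X) * z^`())
   - z * ('X * y^`()^`() + ((a + 1)%:P - 'X) * y^`())); first by ring.
by rewrite Hy Hz -!mul_polyC; ring.
Qed.

(** The derivative of x^(a+1) e^(-x) y_(k+1) y_k is x^a e^(-x) times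
    (k+1) y_(k+1)^2 - (k+1+a) y_k^2 + y_(k+1) y_k, and the last term integrates
    to 0. *)
Lemma laguerre_norm a k : -1 < a ->
  gamma_integral (a + 1) 1 (laguerre k a * laguerre k a) = Gamma (k%:R + a + 1) / k`!%:R.
Proof.
move=> a1; have s0 : 0 < a + 1 by rewrite -ltrBlDr sub0r.
elim: k => [|k IH].
  by rewrite laguerre0 mulr1 fact0 divr1 add0r GammaE.
have := gamma_integral_derive1 (laguerre k.+1 a * laguerre k a) s0.
set y := laguerre k.+1 a in IH *; set z := laguerre k a in IH *.
have -> : ((a + 1)%:P - 'X) * (y * z) + 'X * (y * z)^`() =
    k.+1%:R *: (y * y) - (k.+1%:R + a) *: (z * z) + y * z.
  have Hy := laguerre_lower k a; have Hz := laguerre_raise k a.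
  rewrite -/y -/z in Hy Hz; rewrite derivM mulrDr mulrCA [X in _ + (_ + X)]mulrCA.
  rewrite [X in _ + (X + _)](_ : _ = 'X * y^`() * z); last by ring.
  by rewrite Hy Hz -!mul_polyC; ring.
rewrite gamma_integralD ?gamma_integralB ?gamma_integralZ//; try exact: bounded_away1.
rewrite IH (@laguerre_orthogonal a k.+1 k)//; last by move/eqP; rewrite gtn_eqF.
rewrite addr0 => /eqP; rewrite subr_eq0 => /eqP H.
have k1 : k.+1%:R != 0 :> R by rewrite pnatr_eq0.
apply: (mulfI k1); rewrite H.
have ka : 0 < k%:R + a + 1 by rewrite -addrA ltr_wpDl.
rewrite (_ : k.+1%:R + a + 1 = k%:R + a + 1 + 1); last by rewrite -natr1; ring.
rewrite (GammaS ka) factS natrM.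
by rewrite -natr1 in k1 *; field; rewrite fact_neq0 ?nat1r ?natr1 pnatr_eq0.
Qed.

End LaguerreIntegrals.

Section XLaguerreIntegrals.
Context {R : realType}.
Implicit Types (p q r : {poly R}) (x : R) (n i j k l m : nat).
Variable a : R.
Hypotheses (a_gtN1 : -1 < a) (a_lt0 : a < 0).
Notation den m := (laguerre_opp m (- a - 1)).

Let s0 : 0 < a + 1. Proof. by rewrite -ltrBlDr sub0r. Qed.

(** For a < 0 all the coefficients are positive, so the constant one is a lower
    bound. *)
Lemma bounded_away_den m : bounded_away (den m).
Proof.
have c_gt0 j : (j <= m)%N -> 0 < (den m)`_j.
  move=> jm; rewrite coef_laguerre_opp jm divr_gt0 ?ltr0n ?fact_gt0//.
  apply: gbinom_gt0; rewrite natrB//.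
  have j0 : 0 <= j%:R :> R by [].
  have := a_lt0; lra.
exists (den m)`_0; first exact: c_gt0.
move=> x x0; rewrite laguerre_oppE horner_poly -laguerre_oppE coef_laguerre_opp leq0n.
rewrite big_ord_recl /= expr0 mulr1 lerDl; apply: sumr_ge0 => j _.
rewrite mulr_ge0 ?exprn_ge0 ?(ltW x0)//.
have := c_gt0 (bump 0 j); rewrite coef_laguerre_opp /bump/= add1n ltn_ord.
by move=> /(_ isT)/ltW.
Qed.

Lemma bounded_away_den2 m : bounded_away (den m ^+ 2).
Proof. by rewrite expr2; apply: bounded_awayM; exact: bounded_away_den. Qed.

Lemma weight3E m p x : p.[x] * weight3 m a x = gamma_integrand (a + 1) (den m ^+ 2) p x.
Proof. by rewrite /weight3 /gamma_integrand addrK horner_exp; ring. Qed.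

(** Integration by parts of T_l against (x^(a+1) e^(-x) y_k/q)'. *)
Lemma XLaguerre3_pairing m k l :
  gamma_integral (a + 1) (den m ^+ 2)
    (XLaguerre3 m a (m + k).+1 * XLaguerre3 m a (m + l).+1) =
  (m + l).+1%:R *
  gamma_integral (a + 1 + 1) 1 (laguerre k (a + 1) * laguerre l (a + 1)).
Proof.
have b := bounded_away_den2 m.
set T := XLaguerre3 m a; set y := fun i => laguerre i (a + 1).
have := gamma_integral_derive (T (m + l).+1 * y k) s0 (bounded_away_den m).
rewrite [X in gamma_integral _ _ X](_ : _ =
    (m + l).+1%:R *: ('X * (y k * y l) * den m ^+ 2) - T (m + k).+1 * T (m + l).+1).
  rewrite gamma_integralB// gamma_integralZ// => /eqP; rewrite subr_eq0 => /eqP <-.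
  rewrite -[X in gamma_integral _ X _]mul1r gamma_integral_cancel//.
  by rewrite gamma_integral_shift.
have W := XLaguerre3_wronskian m a k; have D := deriv_XLaguerre3 m a l.
rewrite derivM D -!mul_polyC -/T -/(y l) -/(y k) in W *.
rewrite -[X in _ = _ - X * _]opprK -W -/(y k) -/(y l) -/T; ring.
Qed.

Lemma XLaguerre3_mean m k :
  gamma_integral (a + 1) (den m ^+ 2) (XLaguerre3 m a (m + k).+1) = 0.
Proof.
have := gamma_integral_derive (laguerre k (a + 1)) s0 (bounded_away_den m).
rewrite XLaguerre3_wronskian -[X in gamma_integral _ _ X]scaleN1r gamma_integralZ//.
  by rewrite mulN1r => /eqP; rewrite oppr_eq0 => /eqP.
exact: bounded_away_den2.
Qed.

(** The two contiguous relations make the derivative of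
    x^(a+1) e^(-x)/(q_(m+1) q_m) a combination of the weights of indices m+1
    and m: the cross terms q_(m+1) q_m cancel. *)
Lemma integral_weight3S m :
  (m%:R - a) * gamma_integral (a + 1) (den m.+1 ^+ 2) 1 =
  m.+1%:R * gamma_integral (a + 1) (den m ^+ 2) 1.
Proof.
have bm := bounded_away_den m; have bm1 := bounded_away_den m.+1.
have bM := bounded_awayM bm1 bm.
have b2 : bounded_away ((den m.+1 * den m) ^+ 2) by rewrite expr2; exact: bounded_awayM.
have := gamma_integral_derive 1 s0 bM.
have L := laguerre_opp_lower m (- a - 1); have U := laguerre_opp_raise m (- a - 1).
rewrite [X in gamma_integral _ _ X](_ : _ =
  (m%:R - a) *: (1 * den m ^+ 2) - m.+1%:R *: (1 * den m.+1 ^+ 2)).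
  rewrite (gamma_integralB _ _ s0 b2) !(gamma_integralZ _ _ s0 b2).
  rewrite exprMn gamma_integral_cancel; last exact: bounded_away_den2.
  rewrite [den m.+1 ^+ 2 * _]mulrC gamma_integral_cancel; last exact: bounded_away_den2.
  by move/eqP; rewrite subr_eq0 => /eqP.
rewrite derivC derivM.
transitivity (((a + 1)%:P - 'X) * (den m.+1 * den m) - ('X * (den m.+1)^`()) * den m -
   den m.+1 * ('X * (den m)^`())); first by ring.
by rewrite L U -!mul_polyC -natr1; ring.
Qed.

Lemma integral_weight3 m :
  gamma_integral (a + 1) (den m ^+ 2) 1 =
  Gamma (a + 1) * Gamma (- a) * m`!%:R / Gamma (m%:R - a).
Proof.
have ma n : 0 < n%:R - a by rewrite subr_gt0 (lt_le_trans a_lt0).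
elim: m => [|m IH].
  rewrite laguerre_opp0 expr1n fact0 sub0r mulr1 mulfK -?GammaE//.
  by rewrite gt_eqF// Gamma_gt0// oppr_gt0.
apply: (mulfI (lt0r_neq0 (ma m))); rewrite integral_weight3S IH.
rewrite (_ : m.+1%:R - a = m%:R - a + 1); last by rewrite -natr1; ring.
have g0 := lt0r_neq0 (Gamma_gt0 (ma m)); have m0 := lt0r_neq0 (ma m).
rewrite (GammaS (ma m)) factS natrM; move: (Gamma _) (Gamma _) (Gamma _) g0 => u v w w0.
by move: (m%:R - a) m0 => d d0; field; rewrite w0.
Qed.

End XLaguerreIntegrals.

Theorem theorem5p3 (R : realType) (m : nat) (hm : (1 <= m)%N) (alpha : R)
    (halpha1 : -1 < alpha) (halpha0 : alpha < 0) :
  L2_orthogonal (weight3 m alpha) (XLaguerre_index m)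
    (fun n => poly_cfun (XLaguerre3 m alpha n)) /\
  (forall n : nat, XLaguerre_index m n ->
    (\int[lebesgue_measure]_(x in `]0%R, +oo[)
       ((XLaguerre3 m alpha n).[x] ^+ 2 * weight3 m alpha x)%:E)%E
    = (if n == 0%N
       then Gamma (alpha + 1) * Gamma (- alpha) * m`!%:R / Gamma (m%:R - alpha)
       else n%:R * Gamma (n%:R - m%:R + alpha + 1) / (n - m - 1)`!%:R)%:E).
Proof.
have s0 : 0 < alpha + 1 by rewrite -ltrBlDr sub0r.
have a1 : -1 < alpha + 1 by rewrite (lt_trans _ s0)// ltrN10.
have b := bounded_away_den2 halpha0 m.
set T := XLaguerre3 m alpha.
have index n : XLaguerre_index m n -> n = 0%N \/ exists k, n = (m + k).+1.
  move=> [->|mn]; first by left.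
  by right; exists (n - m.+1)%N; rewrite -addSn subnKC.
have normE n : (\int[lebesgue_measure]_(x in `]0%R, +oo[)
       ((T n).[x] ^+ 2 * weight3 m alpha x)%:E)%E =
    (gamma_integral (alpha + 1) (laguerre_opp m (- alpha - 1) ^+ 2) (T n * T n))%:E.
  rewrite -gamma_integralE//; apply: eq_integral => x _.
  by rewrite -weight3E hornerM expr2.
split; [split|].
- move=> n _; split.
    split; last exact: measurable_cst.
    by apply: measurable_halfline => x _; exact: continuous_horner.
  rewrite [X in (X < _)%E](_ : _ = (gamma_integral (alpha + 1)
      (laguerre_opp m (- alpha - 1) ^+ 2) (T n * T n))%:E) ?ltry// -normE.
  apply: eq_integral => x _; congr ((_ * _)%:E).
  by rewrite /poly_cfun /= expr0n /= addr0 sqr_sqrtr ?sqr_ge0.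
- move=> n k In Ik nk.
  suff H : gamma_integral (alpha + 1) (laguerre_opp m (- alpha - 1) ^+ 2) (T n * T k) = 0.
    rewrite /L2_inner /cintegral /poly_cfun; congr (_ +i* _)%C.
      rewrite -[RHS]H; apply: eq_Rintegral => x _.
      by rewrite -weight3E hornerM /=; ring.
    rewrite -[RHS](mul0r (fine (@lebesgue_measure R `]0, +oo[%classic))).
    rewrite -Rintegral_cst; last exact: measurable_itv.
    by apply: eq_Rintegral => x _ /=; ring.
  case: (index _ In) (index _ Ik) nk => [->|[i ->]] [->|[j ->]] // nk.
  + by rewrite mul1r XLaguerre3_mean.
  + by rewrite mulr1 XLaguerre3_mean.
  + rewrite XLaguerre3_pairing// laguerre_orthogonal// ?mulr0// => ij.
    by apply: nk; rewrite ij.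
- move=> n /index [->|[k ->]]; rewrite normE /=; congr (_%:E).
    by rewrite mulr1 integral_weight3.
  have -> : ((m + k).+1 - m - 1 = k)%N by rewrite -addnS addKn subn1.
  rewrite (XLaguerre3_pairing halpha1 halpha0) (laguerre_norm _ a1) mulrA; congr (_ * Gamma _ / _).
  by rewrite -natr1 natrD; ring.
Qed.
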